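(* Let $X_0 \hookrightarrow X_1 \hookrightarrow \dots \hookrightarrow X_n \hookrightarrow \dots$ and $Y_0 \hookrightarrow Y_1 \hookrightarrow \dots \hookrightarrow Y_n \hookrightarrow \dots$ be two sequences, indexed by the natural numbers $n < \omega$, of core-compact topological spaces with continuous injective transition maps. Then the canonical continuous bijection $$\bigcup_{n<\omega} (X_n \times Y_n) \longrightarrow \Big(\bigcup_{n<\omega} X_n\Big) \times \Big(\bigcup_{n<\omega} Y_n\Big)$$ is a homeomorphism.
   Context: Way-below relation: for two subsets $S, T$ of a topological space $X$, one writes $S \ll T$ if for every family $(U_i)_{i \in I}$ of open subsets of $X$ with $T \subset \bigcup_{i \in I} U_i$, there exists a finite subset $J \subset I$ such that $S \subset \bigcup_{i \in J} U_i$. Core-compact space: a topological space $X$ is core-compact if for every point $x \in X$ and every open neighbourhood $U$ of $x$, there exists an open neighbourhood $V$ of $x$ with $V \ll U$. No separation axiom is assumed. Unions: for a sequence $Z_0 \hookrightarrow Z_1 \hookrightarrow \dots$ of topological spaces with continuous injective transition maps (not assumed to be closed maps or embeddings), $\bigcup_{n<\omega} Z_n$ denotes the sequential colimit in topological spaces: its underlying set is the union (colimit) of the sets $Z_n$, each $Z_n$ being identified with its image, and a subset $U$ is open if and only if $U \cap Z_n$ (the preimage of $U$ in $Z_n$) is open in $Z_n$ for every $n < \omega$. Binary products carry the product topology; the sequence $(X_n \times Y_n)_{n<\omega}$ has as transition maps the products of the transition maps of the two given sequences. The canonical map is the one induced by the maps $X_n \times Y_n \to (\bigcup_m X_m) \times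 (\bigcup_m Y_m)$. *)

(* Defs.v *)
From HB Require Import structures.
From mathcomp Require Import all_boot generic_quotient.
From mathcomp Require Import all_classical topology.

Set Implicit Arguments.
Unset Strict Implicit.
Unset Printing Implicit Defensive.

Local Open Scope classical_set_scope.
Local Open Scope quotient_scope.

Definition way_below (X : topologicalType) (S T : set X) : Prop :=
  forall (I : Type) (U : I -> set X), (forall i, open (U i)) ->
    T `<=` \bigcup_i U i ->
    exists2 J : set I, finite_set J & S `<=` \bigcup_(i in J) U i.

Definition core_compact (X : topologicalType) : Prop :=
  forall (x : X) (U : set X), open_nbhs x U ->
    exists2 V : set X, open_nbhs x V & way_below V U.

Definition homeomorphism (X Y : topologicalType) (h : X -> Y) : Prop :=
  continuous h /\
  exists g : Y -> X, [/\ cancel h g, cancel g h & continuous g].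

Section SequentialColimit.
Context (Z : nat -> topologicalType) (f : forall n, Z n -> Z n.+1).
Implicit Types a b c : {n & Z n}.

Definition seqcolim_step a : {n & Z n} :=
  existT Z (projT1 a).+1 (f (projT2 a)).

(* Directed colimit of sets: two points are identified when they become equal
   at some later stage. The stage is recorded in {n & Z n}, so an equation
   between iterates forces both sides to be at the same stage. *)
Let seqcolim_rel' a b : bool :=
  `[< exists k l, iter k seqcolim_step a = iter l seqcolim_step b >].

Local Lemma seqcolim_rel_refl : reflexive seqcolim_rel'.
Proof. by move=> a; apply/asboolP; exists 0, 0. Qed.

Local Lemma seqcolim_rel_sym : symmetric seqcolim_rel'.
Proof.
by move=> a b; apply/asboolP/asboolP => -[k [l e]]; exists l, k; rewrite e.
Qed.

Local Lemma seqcolim_rel_trans : transitive seqcolim_rel'.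
Proof.
move=> b a c /asboolP[k [l ab]] /asboolP[p [q bc]]; apply/asboolP.
by exists (p + k), (l + q); rewrite !iterD ab -bc -!iterD addnC.
Qed.

Definition seqcolim_rel :=
  EquivRel _ seqcolim_rel_refl seqcolim_rel_sym seqcolim_rel_trans.

(* The colimit carries the quotient of the disjoint union topology, i.e. the
   final topology with respect to the maps seqcolim_in n; see seqcolim_openP. *)
Definition seqcolim : Type := {eq_quot seqcolim_rel}.

HB.instance Definition _ :=
  Topological.copy seqcolim (quotient_topology seqcolim).
HB.instance Definition _ := Quotient.on seqcolim.

Definition seqcolim_in n (x : Z n) : seqcolim := \pi_seqcolim (existT Z n x).

(* The map induced by a cocone h. It is defined through representatives, hence
   meaningful only when h is compatible with the transition maps; see
   seqcolim_descE. *)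
Definition seqcolim_desc (T : Type) (h : forall n, Z n -> T) : seqcolim -> T :=
  fun z => h (projT1 (repr z)) (projT2 (repr z)).

Lemma seqcolim_openP (U : set seqcolim) :
  open U <-> forall n, open (@seqcolim_in n @^-1` U).
Proof. exact: sigT_openP. Qed.

Lemma seqcolim_inS n (x : Z n) : seqcolim_in (f x) = seqcolim_in x.
Proof. by apply/eqmodP/asboolP; exists 0, 1. Qed.

Lemma seqcolim_in_surj (z : seqcolim) : exists n (x : Z n), seqcolim_in x = z.
Proof.
exists (projT1 (repr z)), (projT2 (repr z)).
by rewrite /seqcolim_in -sigT_eta reprK.
Qed.

Lemma seqcolim_in_inj n :
  (forall m, injective (@f m)) -> injective (@seqcolim_in n).
Proof.
move=> finj x y /eqmodP/asboolP[k [l e]].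
have stage a i : projT1 (iter i seqcolim_step a) = i + projT1 a.
  by elim: i => //= i ->.
have kl : k = l.
  by apply: (@addIn n); have /(congr1 (@projT1 _ _)) := e; rewrite !stage.
rewrite -kl in e.
have step_inj : injective seqcolim_step.
  move=> [i u] [j v] uv; have [ij] := congr1 (@projT1 _ _) uv.
  move: v uv; rewrite -ij => v uv.
  by congr (existT _ _ _); apply: (finj i); exact: (existT_inj2 uv).
have: existT Z n x = existT Z n y; last exact: existT_inj2.
by elim: k e {kl} => //= k IHk /step_inj/IHk.
Qed.

Lemma seqcolim_descE (T : Type) (h : forall n, Z n -> T) :
  (forall n x, h n.+1 (f x) = h n x) ->
  forall n (x : Z n), seqcolim_desc h (seqcolim_in x) = h n x.
Proof.
move=> hf n x; pose h' a := h (projT1 a) (projT2 a).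
have hstep a k : h' (iter k seqcolim_step a) = h' a.
  by elim: k => //= k <-; exact: hf.
have : \pi_seqcolim (repr (seqcolim_in x)) = \pi_seqcolim (existT Z n x).
  by rewrite reprK.
move=> /eqmodP/asboolP[k [l e]].
by rewrite /seqcolim_desc -[LHS]/(h' _) -(hstep _ k) e hstep.
Qed.

End SequentialColimit.

Section Product.
Context (X Y : nat -> topologicalType).
Context (f : forall n, X n -> X n.+1) (g : forall n, Y n -> Y n.+1).

Definition prod_seq (n : nat) : topologicalType := (X n * Y n)%type.

Definition prod_seq_map n (p : prod_seq n) : prod_seq n.+1 :=
  (f p.1, g p.2).

Definition seqcolim_prod_map :
    seqcolim prod_seq_map -> (seqcolim f * seqcolim g)%type :=
  seqcolim_desc
    (fun n (p : prod_seq n) => (seqcolim_in f p.1, seqcolim_in g p.2)).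

Lemma seqcolim_prod_mapE n (x : X n) (y : Y n) :
  seqcolim_prod_map (seqcolim_in prod_seq_map (n := n) (x, y)) =
  (seqcolim_in f x, seqcolim_in g y).
Proof.
by rewrite /seqcolim_prod_map seqcolim_descE// => m p; rewrite !seqcolim_inS.
Qed.

End Product.

Arguments seqcolim_prod_map {X Y} f g.

(* Main.v *)
Require Import Defs.
From mathcomp Require Import all_boot generic_quotient.
From mathcomp Require Import all_classical topology.

(* A point of the product of the colimits has representatives at a common stage.
   From there one builds, stage by stage, open rectangles A_k x B_k inside the
   given open set, each mapped into the next. To be able to continue, each
   A_k x B_k is kept way below an open rectangle still contained in the open set:
   continuous images preserve the way-below relation, a tube lemma fattens the
   image of that larger rectangle, and interpolation restores the invariant at
   the next stage. The union of the A_k x B_k yields a product neighbourhood in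
   the colimits. The disjoint unions {n & X n} and {n & Y n}, with the maps
   raising the stage by one, replace the sequences, so that the induction takes
   place in two fixed core-compact spaces. *)

Set Implicit Arguments.
Unset Strict Implicit.
Unset Printing Implicit Defensive.

Local Open Scope classical_set_scope.

(** * The way-below relation and interpolation *)

Section WayBelow.
Context {X : topologicalType}.
Implicit Types (A B S T U V W O : set X).

Lemma way_below0 : way_below (@set0 X) set0.
Proof. by move=> I U _ _; exists set0. Qed.

Lemma way_belowU S T U V :
  way_below S U -> way_below T V -> way_below (S `|` T) (U `|` V).
Proof.
move=> SU TV I F oF UVF.
have [x Ux|J finJ SJ] := SU I F oF; first by apply: UVF; left.
have [x Vx|K finK TK] := TV I F oF; first by apply: UVF; right.
exists (J `|` K); first by rewrite finite_setU.
by rewrite bigcup_setU; exact: setUSS.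
Qed.

Lemma way_below_subl S T U : S `<=` T -> way_below T U -> way_below S U.
Proof.
move=> ST TU I F oF /(TU I F oF)[J finJ TJ].
by exists J => //; exact: subset_trans TJ.
Qed.

Lemma way_below_subr S T U : T `<=` U -> way_below S T -> way_below S U.
Proof.
by move=> TU ST I F oF UF; apply: (ST I F oF); exact: subset_trans UF.
Qed.

Lemma way_below_sub S T : open T -> way_below S T -> S `<=` T.
Proof.
move=> oT /(_ unit (fun=> T))[//||J _ SJ]; first by move=> x Tx; exists tt.
by move=> x /SJ[].
Qed.

(** The open sets satisfying [P] cover [T], so finitely many of them cover [S], and their union
    still satisfies [P]. *)
Lemma way_below_ind (P : set X -> Prop) S T :
  P set0 -> (forall U V, P U -> P V -> P (U `|` V)) ->
  (forall x, T x -> exists2 U, open_nbhs x U & P U) ->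
  way_below S T -> exists O, [/\ open O, S `<=` O & P O].
Proof.
(* [{classic _}] supplies the structure needed to enumerate the finite index set as a list, on which
   the induction runs. *)
move=> P0 PU PT ST; pose I : choiceType := {classic {U | open U /\ P U}}.
have [||J /(@finite_seqP I)[s Js] SJ] :=
  ST I (fun i => sval (i : {U | open U /\ P U})).
- by move=> [U []].
- move=> x /PT[U [oU Ux] PUx].
  by exists (exist (fun U => open U /\ P U) U (conj oU PUx)).
suff [O [oO sO PO]] : exists O, [/\ open O,
    \bigcup_(i in [set` s]) sval (i : {U | open U /\ P U}) `<=` O & P O].
  by exists O; split=> //; apply: subset_trans SJ _; rewrite Js.
elim: s {Js} => [|i s [O [oO sO PO]]].
  by exists set0; split=> //; [exact: open0 | move=> x []].
have [oi Pi] := svalP (i : {U | open U /\ P U}).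
exists (sval (i : {U | open U /\ P U}) `|` O); split=> //.
- exact: openU.
- move=> x [j] /=; rewrite inE => /orP[/eqP->|js jx]; first by left.
  by right; apply: sO; exists j.
- exact: PU.
Qed.

Hypothesis ccX : core_compact X.

(** Core-compactness applied twice puts around each point of [T] an open [U] way below an open [V]
    way below [T]; finite unions keep this pattern, so [way_below_ind] applies. *)
Lemma core_compact_interpolation S T : open T -> way_below S T ->
  exists O, [/\ open O, way_below S O & way_below O T].
Proof.
move=> oT; case/(@way_below_ind (fun U => exists O,
    [/\ open O, way_below U O & way_below O T])).
- by exists set0; split; [exact: open0| exact: way_below0|
    exact: way_below_subr way_below0].
- move=> U V [O [oO UO OT]] [O' [oO' VO' OT']].
  exists (O `|` O'); split; first exact: openU.
    exact: way_belowU.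
  by rewrite -(setUid T); exact: way_belowU.
- move=> x Tx; have [V [oV Vx] VT] := ccX (conj oT Tx).
  have [U oU UV] := ccX (conj oV Vx).
  by exists U => //; exists V.
move=> U [oU SU [O [oO UO OT]]]; exists O; split=> //.
exact: way_below_subl UO.
Qed.

End WayBelow.

Lemma way_below_image (X Y : topologicalType) (h : X -> Y) (S T : set X) :
  continuous h -> way_below S T -> way_below (h @` S) (h @` T).
Proof.
move=> hc ST I F oF TF.
have [||J finJ SJ] := ST I (fun i => h @^-1` F i).
- by move=> i; apply: open_comp => // x _; exact: hc.
- by move=> x Tx; apply: TF; exists x.
by exists J => // _ [x Sx <-]; have [i Ji Fx] := SJ _ Sx; exists i.
Qed.

(** The inclusion of a summand is continuous and open, so it carries a way-below neighbourhood to
    one in the disjoint union. *)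
Lemma core_compact_sigT (X : nat -> topologicalType) :
  (forall n, core_compact (X n)) -> core_compact {n & X n}.
Proof.
move=> cc [n x] U [/sigT_openP/(_ n) oU Ux].
have [V [oV Vx] VU] := cc n x _ (conj oU Ux).
exists (existT X n @` V); first by split; [exact: existT_open_map|exists x].
apply: way_below_subr (way_below_image (@existT_continuous _ X n) VU).
by move=> _ [y Uy <-].
Qed.

(** * Tube lemma and chains of open rectangles *)

Section Tube.
Context {X Y : topologicalType}.
Implicit Type W : set (X * Y).

Lemma open_setX_nbhs W x y : open W -> W (x, y) ->
  exists P Q, [/\ open_nbhs x P, open_nbhs y Q & P `*` Q `<=` W].
Proof.
move=> oW Wxy; have : nbhs (x, y) W by exact: open_nbhs_nbhs.
case=> -[/= P Q] [].
rewrite !nbhsE /= => -[P' oP' P'P] [Q' oQ' Q'Q] PQW.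
exists P', Q'; split=> // -[u v] [/= /P'P Pu /Q'Q Qv].
exact: PQW.
Qed.

(* The tube lemma, with way-below playing the part of compactness. *)
Lemma way_below_tube (A A' : set X) (B B' : set Y) W : open W ->
  way_below A A' -> way_below B B' -> A' `*` B' `<=` W ->
  exists P Q, [/\ open P, open Q, A `<=` P, B `<=` Q & P `*` Q `<=` W].
Proof.
move=> oW AA' BB' ABW.
(* Outer induction over [B']: the sets [Q] grow by unions while the sets [P] containing [A] shrink
   by intersections. *)
have [|U V [P [oP AP PU]] [Q [oQ AQ QV]]|y B'y|Q [oQ BQ [P [oP AP PQ]]]] :=
  @way_below_ind _ (fun Q => exists P, [/\ open P, A `<=` P & P `*` Q `<=` W])
    B B' _ _ _ BB'.
- by exists setT; split=> //; [exact: openT|case=> ? ? []].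
- exists (P `&` Q); split; first exact: openI.
    by rewrite subsetI.
  move=> [u v] [[/= Pu Qu] [Uv|Vv]]; [exact: PU|exact: QV].
(* Inner induction over [A'] with [y] fixed: now [P] grows and the neighbourhood [Q] of [y]
   shrinks. *)
- have [|U V [P [oP PU]] [Q [oQ QV]]|x A'x|P [oP AP [Q [oQ PQ]]]] :=
    @way_below_ind _ (fun P => exists Q, open_nbhs y Q /\ P `*` Q `<=` W)
      A A' _ _ _ AA'.
  + by exists setT; split=> [|[? ?] []//]; split=> //; exact: openT.
  + exists (P `&` Q); split; first exact: open_nbhsI.
    by move=> [u v] [[Uu|Vu] [/= Pv Qv]]; [exact: PU|exact: QV].
  + have [P [Q [oP oQ PQ]]] :=
      @open_setX_nbhs W x y oW (ABW (x, y) (conj A'x B'y)).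
    by exists P => //; exists Q.
  + by exists Q => //; exists P.
by exists P, Q.
Qed.

Context (s : X -> X) (t : Y -> Y).
Hypotheses (ccX : core_compact X) (ccY : core_compact Y).
Hypotheses (sc : continuous s) (tc : continuous t).

Lemma core_compact_rectangle_chain W x y : open W ->
  (forall u v, W (u, v) -> W (s u, t v)) -> W (x, y) ->
  exists (A : nat -> set X) (B : nat -> set Y),
  [/\ A 0 x /\ B 0 y,
      forall k, open (A k) /\ open (B k),
      forall k, s @` A k `<=` A k.+1,
      forall k, t @` B k `<=` B k.+1 &
      forall k, A k `*` B k `<=` W].
Proof.
move=> oW stW Wxy.
pose inv (R : set X * set Y) := [/\ open R.1, open R.2 & exists A B,
  [/\ open A, open B, way_below R.1 A, way_below R.2 B & A `*` B `<=` W]].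
have start : exists R, inv R /\ R.1 x /\ R.2 y.
  have [P [Q [oP oQ PQ]]] := open_setX_nbhs oW Wxy.
  have [A [oA Ax] AP] := ccX oP; have [B [oB By] BQ] := ccY oQ.
  exists (A, B); split=> //; split=> //.
  by exists P, Q; split=> //; [case: oP|case: oQ].
(* The implication sits under the existential so that [choice] yields a total step function;
   rectangles violating [inv] get a dummy value. *)
have next R : exists R', inv R ->
    [/\ inv R', s @` R.1 `<=` R'.1 & t @` R.2 `<=` R'.2].
  have [iR|niR] := pselect (inv R); last by exists R.
  case: iR => _ _ [A [B [oA oB RA RB ABW]]].
  (* [A1] plays two parts: being way below [A], its image can be fattened to [P] by the tube lemma;
     being way above [R.1], it makes the image of [R.1] way below [P], which leaves room for [C]. *)
  have [A1 [oA1 RA1 A1A]] := core_compact_interpolation ccX oA RA.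
  have [B1 [oB1 RB1 B1B]] := core_compact_interpolation ccY oB RB.
  have [|P [Q [oP oQ A1P B1Q PQW]]] := way_below_tube oW
      (way_below_image sc A1A) (way_below_image tc B1B).
    by move=> [_ _] [/= [u Au <-] [v Bv <-]]; apply: stW; exact: ABW.
  have [C [oC A1C CP]] := core_compact_interpolation ccX oP
    (way_below_subr A1P (way_below_image sc RA1)).
  have [D [oD B1D DQ]] := core_compact_interpolation ccY oQ
    (way_below_subr B1Q (way_below_image tc RB1)).
  exists (C, D) => _; split=> /=.
  - by split=> //; exists P, Q.
  - exact: way_below_sub A1C.
  - exact: way_below_sub B1D.
have [N NP] := choice next; have [R0 [iR0 [R0x R0y]]] := start.
pose R k := iter k N R0.
have iR k : inv (R k) by elim: k => //= k /NP[].
exists (fun k => (R k).1), (fun k => (R k).2); split=> //.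
- by move=> k; case: (iR k).
- by move=> k; have [] := NP _ (iR k).
- by move=> k; have [] := NP _ (iR k).
- move=> k [u v] [/= Ru Rv]; have [_ _ [A [B [oA oB RA RB AB]]]] := iR k.
  by apply: AB; split;
    [exact: way_below_sub RA _ Ru|exact: way_below_sub RB _ Rv].
Qed.

End Tube.

Lemma iter_chain (T : Type) (s : T -> T) (A : nat -> set T) j k a :
  (forall k, s @` A k `<=` A k.+1) -> A k a -> A (j + k) (iter j s a).
Proof.
by move=> sA Aka; elim: j => //= j IH; apply: sA; exists (iter j s a).
Qed.

(** * Points and open sets of a sequential colimit *)

Section Colimit.
Context (Z : nat -> topologicalType) (f : forall n, Z n -> Z n.+1).
Local Notation step := (seqcolim_step f).

Lemma seqcolim_step_continuous :
  (forall n, continuous (@f n)) -> continuous step.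
Proof.
move=> fc.
apply: (@sigT_continuous _ Z _ (fun n x => existT Z n.+1 (f x))) => n x.
apply: (@continuous_comp _ _ _ (@f n) (existT Z n.+1)); first exact: fc.
exact: existT_continuous.
Qed.

Lemma seqcolim_in_continuous n : continuous (@seqcolim_in Z f n).
Proof. by apply/continuousP => U /seqcolim_openP. Qed.

Lemma seqcolim_in_eqP m n (x : Z m) (y : Z n) :
  seqcolim_in f x = seqcolim_in f y <->
  exists k l, iter k step (existT Z m x) = iter l step (existT Z n y).
Proof.
by split=> [/eqmodP/asboolP|xy]; last exact/eqmodP/asboolP.
Qed.

Definition seqcolim_class (a : {n & Z n}) : seqcolim f :=
  seqcolim_in f (projT2 a).

Lemma seqcolim_class_iter k a :
  seqcolim_class (iter k step a) = seqcolim_class a.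
Proof. by elim: k => //= k <-; exact: seqcolim_inS. Qed.

(** A point of [Z n] has its class in the image exactly when some iterate of [step] sends it into
    some [A k], an open condition because iterates are continuous. *)
Lemma open_seqcolim_class_image (A : nat -> set {n & Z n}) :
  (forall n, continuous (@f n)) -> (forall k, open (A k)) ->
  (forall k, step @` A k `<=` A k.+1) ->
  open (seqcolim_class @` \bigcup_k A k).
Proof.
move=> fc oA sA.
have itc k : continuous (iter k step).
  elim: k => [|k IH] a; first by move=> U.
  by apply: (@continuous_comp _ _ _ (iter k step) step);
    [exact: IH|exact: seqcolim_step_continuous].
apply/seqcolim_openP => n.
rewrite (_ : _ @^-1` _ =
    existT Z n @^-1` \bigcup_j (iter j step @^-1` \bigcup_k A k)).
  apply/(iffLR (sigT_openP _)); apply: bigcup_open => j _.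
  apply: open_comp => [a _|]; first exact: itc.
  by apply: bigcup_open => k _; exact: oA.
apply/seteqP; split=> x /=.
  move=> [[m y] [k _ Aky]] /seqcolim_in_eqP[i [j e]].
  (* The common iterate is [i] steps beyond a point of [A k], hence lies in [A (i + k)]. *)
  by exists j => //=; exists (i + k) => //; rewrite -e; exact: iter_chain.
move=> [j _ [k _ Ak]]; exists (iter j step (existT Z n x)); first by exists k.
by rewrite seqcolim_class_iter.
Qed.

Lemma seqcolim_in_leq m n (x : Z m) : m <= n ->
  exists y : Z n, seqcolim_in f y = seqcolim_in f x.
Proof.
elim: n => [|n IH]; first by rewrite leqn0 => /eqP e; subst m; exists x.
rewrite leq_eqVlt => /orP[/eqP e|/IH[y yx]]; first by subst m; exists x.
by exists (f y); rewrite seqcolim_inS.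
Qed.

End Colimit.

(** * The canonical map from the colimit of products *)

Section Product.
Context (X Y : nat -> topologicalType).
Context (f : forall n, X n -> X n.+1) (g : forall n, Y n -> Y n.+1).
Local Notation h := (seqcolim_prod_map f g).

Lemma seqcolim_prod_map_continuous : continuous h.
Proof.
apply/continuousP => W oW; apply/seqcolim_openP => n.
rewrite (_ : _ @^-1` _ =
    (fun p : X n * Y n => (seqcolim_in f p.1, seqcolim_in g p.2)) @^-1` W);
  last first.
  by apply/seteqP; split=> -[x y] /=; rewrite seqcolim_prod_mapE.
apply: open_comp => // p _.
apply: (@cvg_pair _ _ _ (nbhs p) (nbhs (seqcolim_in f p.1))
  (nbhs (seqcolim_in g p.2))).
- apply: (@continuous_comp _ _ _ (fun q : X n * Y n => q.1)
    (@seqcolim_in X f n)).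
    exact: cvg_fst.
  exact: seqcolim_in_continuous.
- apply: (@continuous_comp _ _ _ (fun q : X n * Y n => q.2)
    (@seqcolim_in Y g n)).
    exact: cvg_snd.
  exact: seqcolim_in_continuous.
Qed.

Lemma seqcolim_prod_map_surj p : exists z, h z = p.
Proof.
case: p => u v; have [m [x <-]] := seqcolim_in_surj u.
have [n [y <-]] := seqcolim_in_surj v.
have [x' <-] := seqcolim_in_leq f x (leq_maxl m n).
have [y' <-] := seqcolim_in_leq g y (leq_maxr m n).
by exists (seqcolim_in (prod_seq_map f g) (n := maxn m n) (x', y'));
  rewrite seqcolim_prod_mapE.
Qed.

Lemma seqcolim_prod_map_inj : (forall n, injective (@f n)) ->
  (forall n, injective (@g n)) -> injective h.
Proof.
move=> finj ginj z w; have [m [p <-]] := seqcolim_in_surj z.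
have [n [q <-]] := seqcolim_in_surj w.
have [[x y] <-] := seqcolim_in_leq (prod_seq_map f g) p (leq_maxl m n).
have [[x' y'] <-] := seqcolim_in_leq (prod_seq_map f g) q (leq_maxr m n).
by rewrite !seqcolim_prod_mapE => -[/(seqcolim_in_inj finj)->
  /(seqcolim_in_inj ginj)->].
Qed.

(* Pairs of points at a common stage, the only ones at which membership in a
   subset of the colimit of the products can be tested directly. *)
Definition same_stage_preimage (W : set (seqcolim (prod_seq_map f g))) :
    set ({n & X n} * {n & Y n}) :=
  [set p | exists n (x : X n) (y : Y n),
    p = (existT X n x, existT Y n y) /\
    W (seqcolim_in (prod_seq_map f g) (n := n) (x, y))].

(** A rectangle inside stage [n] stays open in the product of disjoint unions, and all its pairs
    share that stage. *)
Lemma open_same_stage_preimage W : open W -> open (same_stage_preimage W).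
Proof.
move=> /seqcolim_openP oW; rewrite openE => _ [n [x [y [-> Wxy]]]].
have [P [Q [[oP Px] [oQ Qy] PQ]]] := open_setX_nbhs (oW n) Wxy.
exists (existT X n @` P, existT Y n @` Q).
  by split; apply: existT_nbhs; exact: open_nbhs_nbhs.
move=> [_ _] [/= [u Pu <-] [v Qv <-]]; exists n, u, v; split=> //.
exact: (PQ (u, v)).
Qed.

Lemma same_stage_preimage_step W a b : same_stage_preimage W (a, b) ->
  same_stage_preimage W (seqcolim_step f a, seqcolim_step g b).
Proof.
move=> [n [x [y [[-> ->] Wxy]]]]; exists n.+1, (f x), (g y); split=> //.
by rewrite -[(f x, g y)]/(prod_seq_map f g (x, y)) seqcolim_inS.
Qed.

Lemma seqcolim_prod_map_open :
  (forall n, core_compact (X n)) -> (forall n, core_compact (Y n)) ->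
  (forall n, continuous (@f n)) -> (forall n, continuous (@g n)) ->
  forall W, open W -> open (h @` W).
Proof.
move=> ccX ccY fc gc W oW; rewrite openE => _ [z Wz <-].
have [n [[x y] zE]] := seqcolim_in_surj z; rewrite -zE in Wz *.
have [|A [B [[Ax By] oAB sA sB ABW]]] := @core_compact_rectangle_chain _ _
  _ _ (core_compact_sigT ccX) (core_compact_sigT ccY)
  (seqcolim_step_continuous fc) (seqcolim_step_continuous gc)
  _ (existT X n x) (existT Y n y) (open_same_stage_preimage oW)
  (@same_stage_preimage_step W).
  by exists n, x, y.
rewrite seqcolim_prod_mapE.
exists (seqcolim_class f @` \bigcup_k A k, seqcolim_class g @` \bigcup_k B k).
  split; apply: open_nbhs_nbhs; split => /=.
  - by apply: open_seqcolim_class_image => // k; case: (oAB k).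
  - by exists (existT X n x) => //; exists 0.
  - by apply: open_seqcolim_class_image => // k; case: (oAB k).
  - by exists (existT Y n y) => //; exists 0.
move=> [_ _] [/= [a [k _ Aka] <-] [b [l _ Blb] <-]].
(* The points [a] and [b] may enter their chains at different indices [k] and [l]; advancing each by
   the other's index brings both to [l + k] without changing their classes. *)
have : same_stage_preimage W
    (iter l (seqcolim_step f) a, iter k (seqcolim_step g) b).
  by apply: (ABW (l + k)); split; [|rewrite /= addnC]; exact: iter_chain.
rewrite -(seqcolim_class_iter f l) -(seqcolim_class_iter g k).
move=> [m [u [v [[-> ->] Wuv]]]].
by exists (seqcolim_in (prod_seq_map f g) (n := m) (u, v));
  rewrite ?seqcolim_prod_mapE.
Qed.

End Product.

Theorem mainTheorem1 (X Y : nat -> topologicalType)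
  (f : forall n, X n -> X n.+1) (g : forall n, Y n -> Y n.+1)
  (X_core_compact : forall n, core_compact (X n))
  (Y_core_compact : forall n, core_compact (Y n))
  (f_continuous : forall n, continuous (f n))
  (g_continuous : forall n, continuous (g n))
  (f_injective : forall n, injective (f n))
  (g_injective : forall n, injective (g n)) :
  homeomorphism (seqcolim_prod_map f g).
Proof.
split; first exact: seqcolim_prod_map_continuous.
have [k hk] := choice (@seqcolim_prod_map_surj X Y f g).
have kh : cancel (seqcolim_prod_map f g) k.
  by move=> z; exact: (seqcolim_prod_map_inj f_injective g_injective).
exists k; split=> //; apply/continuousP => W oW.
(* Preimages under the inverse are images under the canonical map, so openness of that map is
   continuity of [k]. *)
rewrite (_ : k @^-1` W = seqcolim_prod_map f g @` W).
  exact: seqcolim_prod_map_open.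
apply/seteqP; split=> [p Wkp|_ [z Wz <-]] /=; last by rewrite kh.
by exists (k p).
Qed.
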